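(* For all integers $n\ge0$, $j\ge1$, every complex number $x$, and for each choice of sign (the same sign throughout), \[ \sum_{k=0}^n\binom{n}{k}2^kF_{jk}(\pm\sqrt5F_j)^{n-k}B_{n-k}(x)=nF_j\Big((\pm\sqrt5F_jx+L_j)^{n-1}+(\pm\sqrt5F_j(x-1)+L_j)^{n-1}\Big). \]
   Context: $F_n$ and $L_n$ denote the Fibonacci and Lucas numbers: $F_0=0,F_1=1$, $L_0=2,L_1=1$, and $u_n=u_{n-1}+u_{n-2}$. The Bernoulli polynomials $B_n(x)$ are defined by $\sum_{n\ge0}B_n(x)\frac{z^n}{n!}=\frac{ze^{xz}}{e^z-1}$. For $n=0$ the right-hand side is $0$. *)

(* Defs.v *)
From mathcomp Require Import all_boot all_order all_algebra.

Set Implicit Arguments.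
Unset Strict Implicit.
Unset Printing Implicit Defensive.

Import GRing.Theory Num.Theory.
Local Open Scope ring_scope.

Fixpoint fib (n : nat) : nat :=
  if n is m.+1 then (if m is p.+1 then fib m + fib p else 1)%N else 0%N.

Fixpoint lucas (n : nat) : nat :=
  if n is m.+1 then (if m is p.+1 then lucas m + lucas p else 1)%N else 2%N.

(* A formal power series in z is its sequence of coefficients. *)
Definition series (A : Type) := nat -> A.

Section Series.
Variable A : comUnitRingType.
Implicit Types (a b : series A) (c : A).

Definition mulS a b : series A :=
  fun n => \sum_(k < n.+1) a k * b (n - k)%N.

(* The first n coefficients of 1 / a, obtained by solving a * (1 / a) = 1
   degree by degree; meaningful when the constant term a 0 is a unit. *)
Fixpoint inv_coefs a (n : nat) : seq A :=
  if n is m.+1 then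
    let s := inv_coefs a m in
    rcons s (((m == 0%N)%:R - \sum_(k < m) s`_k * a (m - k)%N) / a 0%N)
  else [::].

Definition invS a : series A := fun n => (inv_coefs a n.+1)`_n.

(* e^{c z} *)
Definition expS c : series A := fun n => c ^+ n / n`!%:R.

(* e^z - 1 *)
Definition expm1S : series A := fun n => expS 1 n - (n == 0%N)%:R.

(* z * a(z), and a(z) / z for a series without constant term. *)
Definition mulzS a : series A := fun n => if n is m.+1 then a m else 0.
Definition divzS a : series A := fun n => a n.+1.

Lemma size_inv_coefs a n : size (inv_coefs a n) = n.
Proof. by elim: n => //= n IHn; rewrite size_rcons IHn. Qed.

Lemma nth_inv_coefs a n k : (k < n)%N -> (inv_coefs a n)`_k = invS a k.
Proof.
elim: n => // n IHn; rewrite ltnS leq_eqVlt => /predU1P[-> //|lt_kn].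
by rewrite /= nth_rcons size_inv_coefs lt_kn IHn.
Qed.

Lemma mulSV a n : a 0%N \is a GRing.unit -> mulS (invS a) a n = (n == 0%N)%:R.
Proof.
move=> Ua; rewrite /mulS big_ord_recr /= subnn.
rewrite {2}/invS /= nth_rcons size_inv_coefs ltnn eqxx divrK //.
under eq_bigr => k _ do rewrite -(@nth_inv_coefs a n) //.
by rewrite addrC subrK.
Qed.

Lemma mulSA a b d n : mulS a (mulS b d) n = mulS (mulS a b) d n.
Proof.
pose T (u : series A) := \poly_(i < n.+1) u i.
have coefT u k : (k <= n)%N -> (T u)`_k = u k.
  by move=> le_kn; rewrite coef_poly ltnS le_kn.
have coefM u v k : (k <= n)%N -> (T u * T v)`_k = mulS u v k.
  move=> le_kn; rewrite coefM; apply: eq_bigr => i _.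
  rewrite !coefT ?(leq_trans (leq_subr _ _)) //.
  by rewrite (leq_trans _ le_kn) // -ltnS.
transitivity ((T a * (T b * T d))`_n).
  rewrite poly.coefM; apply: eq_bigr => i _.
  by rewrite coefT ?coefM ?leq_subr // -ltnS.
rewrite mulrA poly.coefM; apply: eq_bigr => i _.
by rewrite coefT ?coefM ?leq_subr // -ltnS.
Qed.

End Series.

(* B_n is n! times the coefficient of z^n in z e^{Xz} / (e^z - 1), a quotient
   of two series without constant term, i.e. e^{Xz} / ((e^z - 1) / z). *)
Definition bernoulli (K : numFieldType) (n : nat) : {poly K} :=
  n`!%:R * mulS (expS 'X) (invS (divzS (expm1S {poly K}))) n.

Lemma fact_unit_poly (K : numFieldType) n :
  (n`!%:R : {poly K}) \is a GRing.unit.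
Proof.
rewrite -(rmorph_nat (@polyC K)) rmorph_unit // unitfE pnatr_eq0.
by rewrite -lt0n fact_gt0.
Qed.

(* (\sum_n B_n z^n / n!) * (e^z - 1) = z * e^{Xz} *)
Lemma bernoulli_egf (K : numFieldType) n :
  mulS (fun m => bernoulli K m / m`!%:R) (expm1S {poly K}) n
    = mulzS (expS 'X) n.
Proof.
pose E := divzS (expm1S {poly K}).
have E0 : E 0%N \is a GRing.unit.
  by rewrite /E /divzS /expm1S /expS expr1n subr0 mul1r unitrV fact_unit_poly.
have x0 : expm1S {poly K} 0 = 0.
  by rewrite /expm1S /expS expr0 fact0 divr1 subrr.
have BE m : bernoulli K m / m`!%:R = mulS (expS 'X) (invS E) m.
  by rewrite /bernoulli mulrC mulKr // fact_unit_poly.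
case: n => [|n]; first by rewrite /mulS big_ord_recl big_ord0 x0 mulr0 addr0.
transitivity (mulS (mulS (expS 'X) (invS E)) E n).
  rewrite /mulS big_ord_recr /= subnn x0 mulr0 addr0.
  by apply: eq_bigr => k _; rewrite BE subSn // -ltnS.
rewrite -mulSA {1}/mulS big_ord_recr /= subnn mulSV // eqxx mulr1.
rewrite big1 ?add0r // => k _.
by rewrite mulSV // subn_eq0 leqNgt ltn_ord mulr0.
Qed.

(* Main.v *)
Require Import Defs.
From mathcomp Require Import all_boot all_order all_algebra.
From mathcomp Require Import reals complex.
From mathcomp Require Import ring.

(* With b(z) = sum_m c^m B_m(x) z^m / m! one has b(z) e^{cz} - b(z) = cz e^{cxz},
   so S(t) := n! [z^n] b(z) e^{tz} satisfies S(t + c) - S(t) = n c (cx + t)^(n-1).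
   Let r = ±sqrt 5, A and B the j-th powers of (1 ± r)/2 and c = r F_j = A - B.
   Since r F_{jk} = A^k - B^k, 2A = L_j + c and 2B = L_j - c, r times the sum is
   S(L_j + c) - S(L_j - c), i.e. two unit steps of the difference equation. *)

Set Implicit Arguments.
Unset Strict Implicit.
Unset Printing Implicit Defensive.

Import Order.TTheory GRing.Theory Num.Theory.
Local Open Scope ring_scope.
Local Open Scope complex_scope.

Section BernoulliDifference.
Variable K : numFieldType.
Implicit Types (c t x : K) (a b : series K).

Lemma factr_neq0 n : n`!%:R != 0 :> K.
Proof. by rewrite pnatr_eq0 -lt0n fact_gt0. Qed.

Lemma expSD c t n : mulS (expS c) (expS t) n = expS (c + t) n.
Proof.
rewrite /mulS /expS addrC exprDn mulr_suml; apply: eq_bigr => k _.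
have lekn : (k <= n)%N by rewrite -ltnS.
rewrite -mulr_natl -(bin_fact lekn) !natrM.
have := factr_neq0 k; have := factr_neq0 (n - k).
have : 'C(n, k)%:R != 0 :> K by rewrite pnatr_eq0 -lt0n bin_gt0.
by move=> hC hnk hk; field; rewrite hC hnk hk.
Qed.

Lemma mulS_mulzS a b n : mulS (mulzS a) b n = mulzS (mulS a b) n.
Proof.
rewrite /mulS big_ord_recl /= mul0r add0r; case: n => [|n]; first exact: big_ord0.
by apply: eq_bigr => k _; rewrite /bump subSS.
Qed.

(** The generating function of the $B_m(x)$ with $z$ rescaled to $cz$. Putting $c^m$ into the
    coefficients avoids any division by $c$, so $c = 0$ needs no separate treatment. *)
Definition bernS c x : series K :=
  fun m => c ^+ m * (bernoulli K m).[x] / m`!%:R.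

(** The quotient on the left uses the inverse of a unit of [{poly K}], the one on the right that of
    [K]; multiplying both by $n!$ avoids comparing the two inverses. *)
Lemma horner_div_fact (p : {poly K}) n x : (p / n`!%:R).[x] = p.[x] / n`!%:R.
Proof.
apply: (mulIf (factr_neq0 n)); rewrite divfK ?factr_neq0 //.
rewrite -{2}(divrK (fact_unit_poly K n) p).
by rewrite [RHS]hornerM -polyC_natr hornerC.
Qed.

(** This is [bernoulli_egf] evaluated at $x$, with its $n$-th coefficient multiplied by $c^n$ to
    pass from $z$ to $cz$. *)
Lemma bernS_expm1 c x n :
  mulS (bernS c x) (expS c) n - bernS c x n = c * mulzS (expS (c * x)) n.
Proof.
have := congr1 (fun p => c ^+ n * p.[x]) (bernoulli_egf K n).
rewrite /= {1}/mulS horner_sum mulr_sumr => E.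
transitivity (c ^+ n * (mulzS (expS 'X) n).[x]); last first.
  case: n {E} => [|n] /=; first by rewrite horner0 !mulr0.
  by rewrite /expS horner_div_fact hornerXn exprMn exprS !mulrA.
(* The two convolutions differ only in the term $k = n$: on the left it is [bernS c x n], which the
   subtraction cancels; on the right it vanishes, as $e^z - 1$ has no constant term. *)
rewrite -E /mulS !big_ord_recr /= subnn {2}/expS expr0 fact0 divr1 mulr1 addrK.
rewrite {2}/expm1S /expS expr0 fact0 divr1 subrr mulr0 horner0 mulr0 addr0.
apply: eq_bigr => k _.
rewrite hornerM horner_div_fact /expm1S subn_eq0 leqNgt ltn_ord subr0.
rewrite /expS horner_div_fact expr1n hornerC /bernS.
have -> : c ^+ n = c ^+ k * c ^+ (n - k) by rewrite -exprD subnKC ?(ltnW (ltn_ord k)).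
by ring.
Qed.

(** Multiply [bernS_expm1] by the series $e^{tz}$. *)
Lemma bernS_expS_step c x t n :
  mulS (bernS c x) (expS (c + t)) n - mulS (bernS c x) (expS t) n
    = c * mulzS (expS (c * x + t)) n.
Proof.
have -> : mulS (bernS c x) (expS (c + t)) n
          = mulS (mulS (bernS c x) (expS c)) (expS t) n.
  by rewrite -mulSA; apply: eq_bigr => k _; rewrite expSD.
transitivity (c * mulS (mulzS (expS (c * x))) (expS t) n).
  rewrite ![mulS _ (expS t) n]/mulS -sumrB mulr_sumr; apply: eq_bigr => k _.
  by rewrite -mulrBl bernS_expm1 -mulrA.
by rewrite mulS_mulzS; case: n => [|n] //=; rewrite expSD.
Qed.

Definition bern_sum n c x t : K :=
  \sum_(k < n.+1) 'C(n, k)%:R * t ^+ k * c ^+ (n - k) * (bernoulli K (n - k)).[x].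

Lemma bern_sumE n c x t : bern_sum n c x t = n`!%:R * mulS (bernS c x) (expS t) n.
Proof.
(* [bern_sum] indexes by the power of $t$, the convolution by the Bernoulli index; hence the
   reversal $k \mapsto n - k$. *)
rewrite /bern_sum (reindex_inj rev_ord_inj) /= mulr_sumr; apply: eq_bigr => k _.
have lekn : (k <= n)%N by rewrite -ltnS.
rewrite subSS subKn // bin_sub // /bernS /expS -(bin_fact lekn) !natrM.
have := factr_neq0 k; have := factr_neq0 (n - k).
by move=> hnk hk; field; rewrite hnk hk.
Qed.

Lemma bern_sum_step n c x t :
  bern_sum n c x (c + t) - bern_sum n c x t = n%:R * c * (c * x + t) ^+ n.-1.
Proof.
rewrite !bern_sumE -mulrBr bernS_expS_step.
(* At $n = 0$ the truncated exponent [n.-1] is harmless: the factor $n$ kills the right side, the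
   shift in [mulzS] the left. *)
case: n => [|n] /=; first by rewrite !mulr0 !mul0r.
rewrite /expS factS natrM; have := factr_neq0 n.
by move=> ?; field.
Qed.

End BernoulliDifference.

Section Binet.
Variables (K : numFieldType) (r : K).
Hypothesis r2 : r ^+ 2 = 5.

(** $(1+q)/2$ is a root of $a^2 = a + 1$. A separate variable $q$ lets this serve for both $r$ and
    $-r$. *)
Lemma binet_root (q : K) m : q ^+ 2 = 5 ->
  ((1 + q) / 2) ^+ m.+2 = ((1 + q) / 2) ^+ m.+1 + ((1 + q) / 2) ^+ m.
Proof.
move=> q2; set a := (1 + q) / 2.
suff a2 : a ^+ 2 = a + 1 by rewrite !exprS mulrA -expr2 a2; ring.
have -> : a ^+ 2 = (1 + 2 * q + q ^+ 2) / 4 by rewrite /a; field.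
by rewrite q2 /a; field.
Qed.

Lemma binet_fib m :
  r * (fib m)%:R = ((1 + r) / 2) ^+ m - ((1 - r) / 2) ^+ m.
Proof.
have r2N : (- r) ^+ 2 = 5 by rewrite sqrrN.
suff [] : r * (fib m)%:R = ((1 + r) / 2) ^+ m - ((1 - r) / 2) ^+ m /\
  r * (fib m.+1)%:R = ((1 + r) / 2) ^+ m.+1 - ((1 - r) / 2) ^+ m.+1 by [].
elim: m => [|m [IH0 IH1]]; first by split; rewrite /= ?expr0 ?expr1; field.
split=> //.
have -> : fib m.+2 = (fib m.+1 + fib m)%N by [].
by rewrite natrD mulrDr IH0 IH1 !binet_root //; ring.
Qed.

Lemma binet_lucas m :
  (lucas m)%:R = ((1 + r) / 2) ^+ m + ((1 - r) / 2) ^+ m.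
Proof.
have r2N : (- r) ^+ 2 = 5 by rewrite sqrrN.
suff [] : (lucas m)%:R = ((1 + r) / 2) ^+ m + ((1 - r) / 2) ^+ m /\
  (lucas m.+1)%:R = ((1 + r) / 2) ^+ m.+1 + ((1 - r) / 2) ^+ m.+1 by [].
elim: m => [|m [IH0 IH1]]; first by split; rewrite /= ?expr0 ?expr1; field.
split=> //.
have -> : lucas m.+2 = (lucas m.+1 + lucas m)%N by [].
by rewrite natrD IH0 IH1 !binet_root //; ring.
Qed.

Lemma fib_bernoulli_sum n j x :
  \sum_(k < n.+1) 'C(n, k)%:R * 2 ^+ k * (fib (j * k))%:R
      * (r * (fib j)%:R) ^+ (n - k) * (bernoulli K (n - k)).[x]
  = n%:R * (fib j)%:R * ((r * (fib j)%:R * x + (lucas j)%:R) ^+ n.-1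
      + (r * (fib j)%:R * (x - 1) + (lucas j)%:R) ^+ n.-1).
Proof.
have r_neq0 : r != 0.
  by apply/eqP=> r0; move: r2; rewrite r0 expr0n /= => /eqP; rewrite eq_sym pnatr_eq0.
set c := r * (fib j)%:R; set l := (lucas j)%:R.
apply: (mulfI r_neq0).
transitivity (bern_sum n c x (c + l) - bern_sum n c x (l - c)).
  rewrite mulr_sumr -sumrB; apply: eq_bigr => k _.
  have -> : c + l = 2 * ((1 + r) / 2) ^+ j by rewrite /c /l binet_fib binet_lucas; ring.
  have -> : l - c = 2 * ((1 - r) / 2) ^+ j by rewrite /c /l binet_fib binet_lucas; ring.
  (* The $k$-th powers become $2^k((1 \pm r)/2)^{jk}$, whose difference is $2^k r F_{jk}$ by
     [binet_fib]. *)
  rewrite !(exprMn_comm k (mulrC 2 _)) -!exprM.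
  rewrite [LHS](_ : _ = 'C(n, k)%:R * 2 ^+ k * (r * (fib (j * k))%:R)
      * c ^+ (n - k) * (bernoulli K (n - k)).[x]); last by ring.
  by rewrite binet_fib; ring.
(* Telescope through $l$: the step from $l$ to $c + l$ gives the power of $cx + l$, the one from $l
   - c$ to $l$ the power of $c(x-1) + l$. *)
have stepl := bern_sum_step n c x l.
have := bern_sum_step n c x (l - c); rewrite subrKC => steplc.
rewrite -(subrKA (bern_sum n c x l)) stepl steplc.
rewrite (_ : c * x + (l - c) = c * (x - 1) + l); last by ring.
by rewrite /c; ring.
Qed.

End Binet.

Theorem theorem17 (R : realType) (n j : nat) (x : R[i]) (s : bool) :
  (1 <= j)%N ->
  let r5 : R[i] := (-1) ^+ s * (Num.sqrt (5 : R))%:C in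
  let F (m : nat) : R[i] := (fib m)%:R in
  let L (m : nat) : R[i] := (lucas m)%:R in
  \sum_(k < n.+1) 'C(n, k)%:R * 2 ^+ k * F (j * k)%N
      * (r5 * F j) ^+ (n - k) * (bernoulli R[i] (n - k)).[x]
  = n%:R * F j * ((r5 * F j * x + L j) ^+ n.-1
                  + (r5 * F j * (x - 1) + L j) ^+ n.-1).
Proof.
move=> _ r5 F L; apply: fib_bernoulli_sum.
(* Only $r^2 = 5$ has to be checked, and squaring removes the sign, so both choices are covered at
   once. *)
by rewrite exprMn sqrr_sign mul1r -rmorphXn /= sqr_sqrtr ?ler0n // rmorph_nat.
Qed.
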